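(* There is a constant $c>0$ such that for every $d\ge1$ the hypercube $G$ with $n=2^d$ vertices satisfies $\widetilde{\mathsf{VC}}(G)\ge c\,n\log^2 n$.
   Context: The hypercube has vertex set $\{0,1\}^d$, two vertices adjacent iff they differ in exactly one bit; logarithms are base 2. Unweighted deterministic walk: each vertex $u$ has a rotor sequence of length $\tilde d(u)$ of neighbours of $u$, each occurring exactly $\tilde d(u)/\deg(u)$ times, and an initial rotor position; the walk moves from the current vertex to the vertex its rotor points at and then advances that rotor cyclically. $\widetilde{\mathsf{VC}}(G)$ is the maximum over start vertices and all rotor sequences/initial positions (lengths fixed) of the least $t$ by which all vertices have been visited. *)

(* Defs.v *)
From HB Require Import structures.
From mathcomp Require Import all_boot all_order all_algebra.
From mathcomp Require Import reals exp.

Set Implicit Arguments.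
Unset Strict Implicit.
Unset Printing Implicit Defensive.

(* Deterministic (rotor-router) walks on a finite connected graph, given by
   its adjacency relation [e].  The lengths [dt u] of the rotor sequences are
   fixed in advance. *)
Section DeterministicWalk.

Variables (T : finType) (e : rel T) (dt : T -> nat).

Definition deg (u : T) : nat := #|[set v | e u v]|.

Definition rotor_seqs := {dffun forall u : T, (dt u).-tuple T}.

(* When [deg u] divides [dt u], these counts add up to the length [dt u]. *)
Definition balanced (s : rotor_seqs) : bool :=
  [forall u, forall v,
     count_mem v (s u) == if e u v then dt u %/ deg u else 0].

Definition rotors := {s : rotor_seqs | balanced s}.

Definition rotor_pos := {dffun forall u : T, 'I_(dt u)}.

Definition wstate := (T * rotor_pos)%type.

(* [ordS] is the cyclic successor on ['I_(dt u)]. *)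
Definition advance (p : rotor_pos) (x : T) : rotor_pos :=
  [ffun u => if u == x then ordS (p u) else p u].

Definition walk_step (s : rotors) (w : wstate) : wstate :=
  (tnth (val s w.1) (w.2 w.1), advance w.2 w.1).

Definition walk (x : T) (s : rotors) (p : rotor_pos) (t : nat) : T :=
  (iter t (walk_step s) (x, p)).1.

Definition covered_by (x : T) (s : rotors) (p : rotor_pos) (t : nat) : bool :=
  [forall v, exists i : 'I_t.+1, walk x s p i == v].

Hypothesis econn : forall u v : T, connect e u v.
Hypothesis dt_dvd : forall u : T, deg u %| dt u.

Lemma step_other s (w : wstate) u :
  w.1 != u -> (walk_step s w).2 u = w.2 u.
Proof. by move=> ne; rewrite /= ffunE eq_sym (negbTE ne). Qed.

Lemma step_self s (w : wstate) : (walk_step s w).2 w.1 = ordS (w.2 w.1).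
Proof. by rewrite /= ffunE eqxx. Qed.

Lemma first_visit s u k (w : wstate) :
  (iter k (walk_step s) w).1 = u ->
  exists k', (iter k' (walk_step s) w).1 = u /\
             (iter k' (walk_step s) w).2 u = w.2 u.
Proof.
elim: k w => [|k IH] w; first by exists 0.
have [<-|ne] := eqVneq w.1 u; first by exists 0.
rewrite iterSr => /IH[k' [h1 h2]].
by exists k'.+1; rewrite iterSr h2 step_other.
Qed.

Lemma iter_ordS n (q : 'I_n) k : iter k (@ordS n) q = (q + k) %% n :> nat.
Proof.
elim: k => [|k IH]; first by rewrite addn0 modn_small.
by rewrite iterS /= IH addnS -addn1 modnDml addn1.
Qed.

(* Hence the minimum in [cover_time] exists: the walk is eventually periodic,
   and the set of vertices on its cycle is closed under taking neighbours. *)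
Lemma walk_covers x s p : exists t, covered_by x s p t.
Proof.
pose f := walk_step s; pose z0 : wstate := (x, p).
have /trajectP[a lt_a /esym z_per] := looping_order f z0.
set b := fingraph.order f z0 in lt_a z_per.
pose z := iter a f z0; pose m := b - a.
have m_gt0 : 0 < m by rewrite subn_gt0.
have per i : iter m f (iter i f z) = iter i f z.
  rewrite -iterD addnC iterD; congr (iter i f _).
  by rewrite /z -iterD subnK ?(ltnW lt_a).
have next u i : (iter i f z).1 = u ->
    exists j, (iter j f z).1 = u /\ (iter j f z).2 u = ordS ((iter i f z).2 u).
  move=> hu; have hm : (iter m.-1 f (iter i.+1 f z)).1 = u.
    by rewrite iterS -iterSr prednK // per.
  have [k [h1 h2]] := first_visit hm.
  exists (k + i.+1); rewrite !iterD; split=> //.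
  by rewrite h2 iterS -hu step_self.
have nexts u i k : (iter i f z).1 = u ->
    exists j, (iter j f z).1 = u /\
      (iter j f z).2 u = iter k (@ordS _) ((iter i f z).2 u).
  move=> hu; elim: k => [|k [j [h1 h2]]]; first by exists i.
  by have [j' [h3 h4]] := next _ _ h1; exists j'; rewrite h4 h2.
have closed u v i : e u v -> (iter i f z).1 = u -> exists j, (iter j f z).1 = v.
  move=> euv hu; set q := (iter i f z).2 u.
  have dgt : 0 < dt u by apply: leq_ltn_trans (ltn_ord q).
  have vin : v \in val s u.
    rewrite -has_pred1 has_count.
    have /forallP/(_ u)/forallP/(_ v)/eqP -> := valP s.
    rewrite euv divn_gt0; first exact: dvdn_leq.
    by apply/card_gt0P; exists v; rewrite inE.
  have /tnthP[r def_v] := vin.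
  have [j [h1 h2]] := nexts _ _ (r + (dt u - q)) hu.
  exists j.+1; rewrite iterS /= h1 h2 def_v; congr tnth; apply: val_inj.
  rewrite /= iter_ordS -/q addnCA subnKC; last exact: ltnW.
  by rewrite modnDr modn_small.
have all_v v : exists i, walk x s p i = v.
  suff [j <-] : exists j, (iter j f z).1 = v.
    by exists (j + a); rewrite /walk iterD.
  have /connectP[c] := econn z.1 v.
  have : exists i, (iter i f z).1 = z.1 by exists 0.
  elim: c (z.1) => [|y c IH] u [i hi] /=; first by move=> _ ->; exists i.
  by case/andP=> euy pc lc; apply: IH pc lc; apply: closed hi.
have [g hg] := fin_all_exists all_v.
exists (\max_v g v); apply/forallP=> v; apply/existsP.
have lt_g : g v < (\max_v g v).+1 by rewrite ltnS; apply: leq_bigmax.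
by exists (Ordinal lt_g); rewrite /= hg.
Qed.

Definition cover_time (x : T) (s : rotors) (p : rotor_pos) : nat :=
  ex_minn (walk_covers x s p).

(* If some [dt u] is 0 there is no rotor position and this maximum is over the
   empty set, so uses of [VC] should assume [0 < dt u] for all [u]. *)
Definition VC : nat :=
  \max_(x : T) \max_(s : rotors) \max_(p : rotor_pos) cover_time x s p.

End DeterministicWalk.

Definition hypercube (d : nat) : rel {ffun 'I_d -> bool} :=
  fun x y => #|[set i | x i != y i]| == 1.

Lemma hypercube_connected d (x y : {ffun 'I_d -> bool}) :
  connect (@hypercube d) x y.
Proof.
have [k] := ubnP #|[set i | x i != y i]|; elim: k x => // k IH x lek.
have [d0|[i]] := set_0Vmem [set i | x i != y i].
  suff -> : x = y by exact: connect0.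
  apply/ffunP=> i; apply/eqP.
  by have := in_set0 i; rewrite -d0 inE => /negbFE.
move=> iD; pose x' := [ffun j => if j == i then y j else x j].
have xi : x i != y i by move: iD; rewrite inE.
apply: (@connect_trans _ _ x').
  apply: connect1; rewrite /hypercube; apply/cards1P; exists i.
  apply/setP=> j; rewrite !inE ffunE.
  by have [->|] := eqVneq j i; rewrite ?xi ?eqxx.
apply: IH; rewrite (cardsD1 i) iD ltnS in lek; apply: leq_trans lek.
rewrite ltnS; apply: subset_leq_card; apply/subsetP=> j; rewrite !inE ffunE.
by have [->|] := eqVneq j i; rewrite ?eqxx.
Qed.

Definition log2 (R : realType) (x : R) : R := (ln x / ln 2)%R.

(* Main.v *)
(* Start at the all-zero vertex, let every rotor be d-periodic, and let it point
   first to the neighbours with fewer ones.  Suppose the start has been left at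
   most d k times.  By induction on time, a vertex with l <= k ones has been left
   at most d (k - l) + l times, and a vertex with more than k ones never visited:
   these bounds are an exact circulation, and the walk cannot exceed them.  For
   k = d - 1 the antipode is thus unvisited until the start has been left
   d (d - 1) times.  When the walk returns to the start with exactly d k exits
   behind it, the bounds are attained, by induction on l: entries equal exits, so
   a vertex attaining its bound forces every incoming arc to attain its own, and
   the last downward arc of a vertex one level up then determines its exits.
   For k = d - 1, summing over all vertices gives time d (d - 1) 2^(d-1). *)

Require Import Defs.
From mathcomp Require Import all_boot all_order all_algebra.
From mathcomp Require Import reals exp.
From mathcomp Require Import zify.
Import Order.TTheory GRing.Theory Num.Theory.

(** * Uses of one slot of a periodic rotor *)

Section ResidueCount.
Set Implicit Arguments.
Unset Strict Implicit.

Definition residue_count (d N m : nat) : nat := \sum_(j < N) (j %% d == m).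

Lemma residue_countS d N m :
  residue_count d N.+1 m = residue_count d N m + (N %% d == m).
Proof. by rewrite /residue_count big_ord_recr. Qed.

(** Over the integers this is the ceiling of [(N - m) / d]; adding [d - m.+1] avoids truncated
    subtraction. *)
Lemma residue_countE d N m : m < d ->
  residue_count d N m = (N + (d - m.+1)) %/ d.
Proof.
move=> lt_md; have d_gt0 : 0 < d by apply: leq_ltn_trans lt_md.
elim: N => [|N IH]; first by rewrite /residue_count big_ord0 divn_small //; lia.
rewrite residue_countS IH [in LHS]addnC.
have := divn_eq N d; have := ltn_pmod N d_gt0.
move: (N %/ d) (N %% d) => q r lt_rd ->.
rewrite addSn -!addnA -[in RHS]addnS !divnMDl // addnCA; congr (_ + _).
case: (ltngtP r m) => [lt_rm|lt_mr|->].
- by rewrite !divn_small //; lia.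
- rewrite [_ + (_ - _)](_ : _ = 1 * d + (r - m.+1)); last lia.
  rewrite (_ : (_ + (_ - _)).+1 = 1 * d + (r - m)); last lia.
  by rewrite !divnMDl // !divn_small //; lia.
- rewrite (_ : m + (d - m.+1) = d.-1); last lia.
  by rewrite prednK // divnn d_gt0 divn_small //; lia.
Qed.

Lemma residue_count_mul d q m : m < d -> residue_count d (q * d) m = q.
Proof.
move=> lt_md; rewrite residue_countE // divnMDl ?divn_small; lia.
Qed.

(** Occurrence number [q] of the residue [m], counted from 0, is at [d * q + m]. *)
Lemma residue_count_gt d N m q : m < d ->
  (q < residue_count d N m) = (d * q + m < N).
Proof.
move=> lt_md; rewrite residue_countE // leq_divRL; last lia.
rewrite mulSn mulnC; lia.
Qed.

Lemma residue_count_le d N m q : m < d ->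
  (residue_count d N m <= q) = (N <= d * q + m).
Proof. by move=> lt_md; rewrite leqNgt residue_count_gt // -leqNgt. Qed.

End ResidueCount.

Section HypercubeWalk.
Set Implicit Arguments.
Unset Strict Implicit.

(* The cube has dimension [d.+1], so that ['I_d.+1] is inhabited. *)
Variable d : nat.
Notation cube := {ffun 'I_d.+1 -> bool}.
Implicit Types (u v w : cube) (i : 'I_d.+1).

(** * Directions and levels in the cube *)

Definition flip u i : cube := [ffun j => u j (+) (j == i)].
Definition level u : nat := #|[set i | u i]|.
Definition origin : cube := [ffun=> false].
Definition antipode : cube := [ffun=> true].

Lemma flipK i : involutive (flip^~ i).
Proof. by move=> u; apply/ffunP=> j; rewrite !ffunE -addbA addbb addbF. Qed.

Lemma flip_inj u : injective (flip u).
Proof.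
move=> i j /ffunP/(_ i); rewrite !ffunE eqxx => /addbI/esym.
by move/eqP.
Qed.

Lemma eq_flip u v i : (flip u i == v) = (u == flip v i).
Proof. by rewrite -{1}(flipK i v) (can_eq (flipK i)). Qed.

Lemma hypercube_flip u v :
  reflect (exists i, v = flip u i) (@hypercube d.+1 u v).
Proof.
apply: (iffP cards1P) => [[i /setP def_i] | [i ->]]; exists i.
  apply/ffunP=> j; have := def_i j; rewrite !inE ffunE => <-.
  by case: (u j) (v j) => [] [].
by apply/setP=> j; rewrite !inE ffunE; case: (u j) (j == i) => [] [].
Qed.

Lemma deg_hypercube u : deg (@hypercube d.+1) u = d.+1.
Proof.
rewrite /deg -[RHS](card_ord d.+1) -(card_imset _ (@flip_inj u)).
apply: eq_card => v; rewrite inE; apply/hypercube_flip/imsetP.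
  by case=> i ->; exists i.
by case=> i _ ->; exists i.
Qed.

Lemma level_le u : level u <= d.+1.
Proof. by rewrite -[X in _ <= X]card_ord max_card. Qed.

Lemma level_origin : level origin = 0.
Proof. by apply: eq_card0 => i; rewrite !inE ffunE. Qed.

Lemma level_antipode : level antipode = d.+1.
Proof. by rewrite -[RHS]card_ord; apply: eq_card => i; rewrite !inE ffunE. Qed.

Lemma level0 u : level u = 0 -> u = origin.
Proof.
move=> /eqP; rewrite cards_eq0 => /eqP/setP u0; apply/ffunP=> i.
by have := u0 i; rewrite !inE ffunE.
Qed.

Lemma level_flip_down u i : u i -> level u = (level (flip u i)).+1.
Proof.
move=> ui; rewrite /level (cardsD1 i) inE ui; congr _.+1.
apply: eq_card => j; rewrite !inE ffunE.
by have [->|] := eqVneq j i; rewrite ?ui // addbF.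
Qed.

Lemma level_flip_up u i : ~~ u i -> level (flip u i) = (level u).+1.
Proof.
by move=> ui; rewrite (@level_flip_down _ i) ?flipK // ffunE eqxx addbT.
Qed.

(** Complementation pairs [u] with a vertex of level [d.+1 - level u]. *)
Lemma sum_level : 2 * (\sum_u level u) = d.+1 * 2 ^ d.+1.
Proof.
pose compl u : cube := [ffun i => ~~ u i].
have complK : involutive compl.
  by move=> u; apply/ffunP=> i; rewrite !ffunE negbK.
rewrite mul2n -addnn {2}(reindex_inj (inv_inj complK)) -big_split /=.
rewrite (eq_bigr (fun=> d.+1)) => [|u _].
  by rewrite sum_nat_const card_ffun card_bool card_ord mulnC.
rewrite -[RHS](card_ord d.+1) -(cardC [set i | u i]); congr (_ + _).
by apply: eq_card => i; rewrite !inE ffunE.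
Qed.

(** * Down-first rotors *)

Definition down_first u : seq 'I_d.+1 :=
  filter u (enum 'I_d.+1) ++ filter (predC u) (enum 'I_d.+1).

Lemma perm_down_first u : perm_eq (down_first u) (enum 'I_d.+1).
Proof. by apply/permPl/perm_filterC. Qed.

Lemma mem_down_first u i : i \in down_first u.
Proof. by rewrite (perm_mem (perm_down_first u)) mem_enum. Qed.

Lemma size_down_first u : size (down_first u) = d.+1.
Proof. by rewrite (perm_size (perm_down_first u)) size_enum_ord. Qed.

Lemma uniq_down_first u : uniq (down_first u).
Proof. by rewrite (perm_uniq (perm_down_first u)) enum_uniq. Qed.

Definition rank u i : nat := index i (down_first u).
Definition unrank u m : 'I_d.+1 := nth ord0 (down_first u) m.

Lemma rank_lt u i : rank u i < d.+1.
Proof. by rewrite -(size_down_first u) index_mem mem_down_first. Qed.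

Lemma unrankK u m : m < d.+1 -> rank u (unrank u m) = m.
Proof. by move=> lt_m; rewrite /rank index_uniq ?size_down_first ?uniq_down_first. Qed.

Lemma unrank_eq u m i : m < d.+1 -> (unrank u m == i) = (m == rank u i).
Proof.
move=> lt_m; apply/eqP/eqP => [<-|->]; first by rewrite unrankK.
by rewrite /unrank nth_index ?mem_down_first.
Qed.

(** Flipping a set bit goes down one level, so the downward arcs fill the first [level u] slots. *)
Lemma rank_lt_level u i : (rank u i < level u) = u i.
Proof.
rewrite /rank /down_first index_cat mem_filter mem_enum andbT.
have -> : level u = size (filter u (enum 'I_d.+1)).
  rewrite -(card_uniqP (filter_uniq _ (enum_uniq _))).
  by apply: eq_card => j; rewrite inE mem_filter mem_enum andbT.
case: ifP => ui; last by rewrite ltnNge leq_addr.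
by rewrite index_mem mem_filter ui mem_enum.
Qed.


Variable dt : cube -> nat.
Hypothesis dt_gt0 : forall u, 0 < dt u.
Hypothesis dt_dvd : forall u, d.+1 %| dt u.

Definition down_first_seqs : rotor_seqs dt :=
  [ffun u : cube => [tuple flip u (unrank u (j %% d.+1)) | j < dt u]].

Lemma balanced_down_first : balanced (@hypercube d.+1) down_first_seqs.
Proof.
apply/forallP=> u; apply/forallP=> v; rewrite deg_hypercube ffunE.
rewrite count_map -sum1_count big_mkcond /= big_enum /=.
case: hypercube_flip => [[i ->]|not_adj].
  have /dvdnP[q def_dt] := dt_dvd u.
  rewrite def_dt mulnK // -[X in _ == X](residue_count_mul q (rank_lt u i)).
  apply/eqP/eq_bigr => j _.
  by rewrite (inj_eq (@flip_inj u)) unrank_eq ?ltn_pmod //; case: eqP.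
rewrite big1 // => j _; case: eqP => // def_v.
by case: not_adj; exists (unrank u (j %% d.+1)).
Qed.

Definition down_first_rotors : rotors (@hypercube d.+1) dt :=
  exist _ down_first_seqs balanced_down_first.

Definition initial_pos : rotor_pos dt :=
  [ffun u : cube => Ordinal (dt_gt0 u)].

Notation state t :=
  (iter t (walk_step down_first_rotors) (origin, initial_pos)).
Notation position t := (walk origin down_first_rotors initial_pos t).

(** * Exits, entries and their balance *)

Definition exits t v : nat := \sum_(j < t) (position j == v).

(** Each summand is the number of uses of the arc from [flip v i] to [v], recovered from the exits
    of its source. *)
Definition entries t v : nat :=
  \sum_i residue_count d.+1 (exits t (flip v i)) (rank (flip v i) i).

Lemma exitsS t v : exits t.+1 v = exits t v + (position t == v).
Proof. by rewrite /exits big_ord_recr. Qed.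

Lemma sum_exits t : \sum_v exits t v = t.
Proof.
rewrite exchange_big /= -[RHS]card_ord -sum1_card; apply: eq_bigr => j _.
rewrite (bigD1 (position j)) //= eqxx big1 // => v.
by rewrite eq_sym => /negbTE ->.
Qed.

Lemma rotor_position t u : (state t).2 u = exits t u %% dt u :> nat.
Proof.
elim: t => [|t IH]; first by rewrite ffunE /exits big_ord0 mod0n.
rewrite iterS exitsS -/(walk_step _ _) /= ffunE /walk eq_sym.
case: eqP => _; last by rewrite IH addn0.
by rewrite /= IH -addn1 modnDml.
Qed.

(** Since [d.+1] divides [dt u], the rotor index modulo [d.+1] depends on the exit count alone; the
    lengths [dt] drop out from here on. *)
Lemma positionS t : let u := position t in
  position t.+1 = flip u (unrank u (exits t u %% d.+1)).
Proof.
by rewrite /= {1}/walk iterS /= ffunE tnth_mktuple rotor_position modn_dvdm.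
Qed.

(** Both sides count the visits to [v] at times 0 to [t]: by departures plus the pending one, or by
    arrivals plus the start. *)
Lemma conservation t v :
  exits t v + (position t == v) = entries t v + (origin == v).
Proof.
elim: t => [|t IH].
  rewrite /exits big_ord0 /entries big1 // => i _.
  by rewrite /exits big_ord0 /residue_count big_ord0.
rewrite exitsS IH addnAC; congr (_ + _); rewrite positionS.
set u := position t; set m := exits t u %% d.+1.
have lt_m : m < d.+1 by rewrite ltn_pmod.
(* The step from [u] uses only the arc in direction [unrank u m], so only its count grows. *)
rewrite (_ : entries t.+1 v = entries t v +
               \sum_i ((u == flip v i) && (unrank u m == i))).
  congr (_ + _); rewrite (bigD1 (unrank u m)) //= eqxx andbT -eq_flip.
  by rewrite big1 ?addn0 // => i /negbTE; rewrite eq_sym => ->; rewrite andbF.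
rewrite -big_split /=; apply: eq_bigr => i _; rewrite exitsS -/u.
case: eqP => [<-|_]; last by rewrite !addn0.
by rewrite addn1 residue_countS unrank_eq.
Qed.

(* [k.+1 - l] bounds the use of an arc from level [l.-1] to level [l], and
   [k - l] that of an arc from level [l.+1] to level [l]. *)
Definition exit_bound k l : nat := l * (k.+1 - l) + (d.+1 - l) * (k - l).

(** * Upper bounds on arc uses and exits *)

Lemma exit_boundE k l : l <= d.+1 ->
  exit_bound k l = if l <= k then d.+1 * (k - l) + l else 0.
Proof.
move=> le_ld; rewrite /exit_bound; case: leqP => [le_lk|lt_kl]; last first.
  by rewrite (eqP lt_kl) (eqP (ltnW lt_kl)) !muln0.
by rewrite subSn // mulnS -addnA -mulnDl subnKC // addnC.
Qed.

(** A source at level [j <= k] that attains its bound has made [k - j] full turns and then used its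
    [j] downward slots once more: upward arcs get [k - j] uses, downward arcs [k - j + 1]. *)
Lemma residue_count_bound k t v i :
    exits t (flip v i) <= exit_bound k (level (flip v i)) ->
  residue_count d.+1 (exits t (flip v i)) (rank (flip v i) i)
    <= if v i then k.+1 - level v else k - level v.
Proof.
rewrite exit_boundE ?level_le // => leE; rewrite residue_count_le ?rank_lt //.
apply: leq_trans leE _.
have := rank_lt_level (flip v i) i; rewrite ffunE eqxx addbT.
have := level_le (flip v i).
case: (boolP (v i)) => vi.
  rewrite (level_flip_down vi) => le_d /negbT; rewrite -leqNgt => le_r.
  by rewrite subSS; case: (leqP _ k) => // _; lia.
rewrite level_flip_up // => le_d /= lt_r; case: (leqP _ k) => // lt_k.
have -> : k - level v = (k - (level v).+1).+1 by lia.
rewrite mulnS; lia.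
Qed.

Lemma sum_if_level v a b :
  \sum_i (if v i then a else b) = level v * a + (d.+1 - level v) * b.
Proof.
rewrite (bigID v) /= (eq_bigr (fun=> a)) => [|i ->] //.
rewrite [X in _ + X](eq_bigr (fun=> b)) => [|i /negbTE->] //.
rewrite !sum_nat_const; congr (_ * _ + _ * _).
  by apply: eq_card => i; rewrite inE.
rewrite -[X in X - _]card_ord -(cardC [set i | v i]) addKn.
by apply: eq_card => i; rewrite !inE.
Qed.

Lemma entries_bound k t v :
    (forall w, exits t w <= exit_bound k (level w)) ->
  entries t v <= exit_bound k (level v).
Proof.
move=> leE; rewrite /exit_bound -sum_if_level; apply: leq_sum => i _.
exact/residue_count_bound/leE.
Qed.

(** Away from the origin, exits before time [t.+1] equal entries before time [t], by conservation,
    and those entries depend only on exits already bounded by induction. *)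
Lemma exits_bound k t v :
  exits t origin <= d.+1 * k -> exits t v <= exit_bound k (level v).
Proof.
elim: t v => [|t IH] v; first by rewrite /exits !big_ord0.
rewrite !exitsS => leE.
have leEt w := IH w (leq_trans (leq_addr _ _) leE).
have [<-|ne_v0] := eqVneq origin v.
  by rewrite level_origin exit_boundE // subn0 addn0.
by rewrite conservation (negbTE ne_v0) addn0 entries_bound.
Qed.

(** Otherwise the bounds hold with [k = d], and [exit_bound] vanishes at level [d.+1], leaving the
    antipode without entries. *)
Lemma antipode_late t :
  position t = antipode -> d.+1 * d < exits t origin.
Proof.
move=> at_t; rewrite ltnNge; apply/negP => leE.
have := conservation t antipode; rewrite at_t eqxx.
have -> : origin == antipode = false.
  by apply/eqP=> /ffunP/(_ ord0); rewrite !ffunE.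
have := entries_bound antipode (fun w => @exits_bound d t w leE).
rewrite level_antipode exit_boundE // ltnn; lia.
Qed.

(** * Attained bounds at a return to the origin *)

Lemma exits_ge k t : position t = origin -> exits t origin = d.+1 * k ->
  forall v, level v <= k -> d.+1 * (k - level v) + level v <= exits t v.
Proof.
move=> at_t Et v; move def_l: (level v) => l.
elim: l v def_l => [|l IH] w def_w le_k.
  by rewrite (level0 def_w) Et subn0 addn0.
(* As [level w] is [l.+1], slot [l] is the last downward slot of [w]. *)
pose i := unrank w l.
have lt_ld : l < d.+1 by rewrite -def_w level_le.
have ri : rank w i = l by rewrite unrankK.
have wi : w i by rewrite -rank_lt_level ri def_w.
pose v := flip w i.
have lev : level v = l by apply: succn_inj; rewrite -level_flip_down.
have leE u : exits t u <= exit_bound k (level u) by apply: exits_bound; rewrite Et.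
(* With the walk at the origin, the two indicators in [conservation] cancel. *)
have eqS : entries t v = exit_bound k (level v).
  apply/eqP; rewrite eqn_leq entries_bound //= exit_boundE ?level_le //.
  rewrite lev (ltnW le_k); have := conservation t v; rewrite at_t => /addIn <-.
  by apply: IH => //; apply: ltnW.
have : residue_count d.+1 (exits t w) (rank w i) = k - l.
  have vi : v i = false by rewrite ffunE eqxx wi.
  have := eqS; rewrite /exit_bound -sum_if_level => /eqP.
  have bnd j := residue_count_bound (leE (flip v j)).
  (* Equality of the sums forces equality in each term, in particular for the arc from [w]. *)
  have := leqif_sum (fun j (_ : true) => leqif_eq (bnd j)).
  move=> /leqifP; case: ifP => [/forallP/(_ i)|_]; last by move=> /ltn_eqF ->.
  by rewrite /= flipK vi lev => /eqP.
(* The use number [k - l] of slot [l] is exit number [d.+1 * (k - l.+1) + l.+1] from [w], which is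
   the claimed bound. *)
rewrite ri => cnt; have : (k - l.+1) < residue_count d.+1 (exits t w) l.
  by rewrite cnt; lia.
by rewrite residue_count_gt // addnS.
Qed.

(** Exits grow by single units, so the count passes through [a], at a moment when the walk is about
    to leave [u]. *)
Lemma exits_intermediate t a u :
  a < exits t u -> exists2 j, j < t & position j = u /\ exits j u = a.
Proof.
elim: t => [|t IH]; first by rewrite /exits big_ord0.
rewrite exitsS; case: eqP => [at_t|_]; last first.
  by rewrite addn0 => /IH[j lt_j Hj]; exists j; rewrite // ltnS ltnW.
rewrite addn1 ltnS leq_eqVlt => /orP[/eqP def_a|/IH[j lt_j Hj]].
  by exists t.
by exists j; rewrite // ltnS ltnW.
Qed.

Lemma return_time_ge t :
  position t = origin -> exits t origin = d.+1 * d -> d * d.+1 * 2 ^ d <= t.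
Proof.
move=> at_t Et.
(* The lower bound is affine in the level with slope [-d], and trivial at level [d.+1]. Summed over
   the cube, the level term costs half of the total. *)
have leE v : d.+1 * d <= exits t v + d * level v.
  have [le_d|gt_d] := leqP (level v) d; last first.
    by apply: leq_trans (leq_addl _ _); rewrite mulnC leq_mul2l gt_d orbT.
  have := exits_ge at_t Et le_d.
  have := mulnBr d.+1 d (level v); have := leq_mul (leqnn d.+1) le_d.
  lia.
have : \sum_(v : cube) d.+1 * d <= \sum_v (exits t v + d * level v).
  exact: leq_sum.
rewrite sum_nat_const card_ffun card_bool card_ord.
rewrite big_split /= sum_exits -big_distrr /=; have := sum_level; rewrite expnS.
move: (\sum_u _) (2 ^ d) => S P eqS; have -> : S = d.+1 * P by lia.
lia.
Qed.

(** * From the return time to the cover time *)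

Lemma VC_hypercube_gt (dt_deg : forall u, deg (@hypercube d.+1) u %| dt u) :
  d * d.+1 * 2 ^ d < VC (@hypercube_connected d.+1) dt_deg.
Proof.
rewrite /VC; apply: leq_trans (leq_bigmax origin).
apply: leq_trans (leq_bigmax down_first_rotors).
apply: leq_trans (leq_bigmax initial_pos).
rewrite /cover_time; case: ex_minnP => m /forallP/(_ antipode).
case/existsP=> j /eqP at_j _.
have [t lt_tj [at_t Et]] := exits_intermediate (antipode_late at_j).
have lt_tm : t < m by apply: leq_trans lt_tj _; rewrite -ltnS.
exact: leq_ltn_trans (return_time_ge at_t Et) lt_tm.
Qed.

End HypercubeWalk.

Local Open Scope ring_scope.

Theorem theorem4p8 (R : realType) :
  exists2 c : R, 0 < c &
    forall (d n : nat), (1 <= d)%N -> n = (2 ^ d)%N ->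
    forall (dt : {ffun 'I_d -> bool} -> nat)
           (dt_gt0 : forall u, (0 < dt u)%N)
           (dt_dvd : forall u, (deg (@hypercube d) u %| dt u)%N),
      c * n%:R * log2 (n%:R) ^+ 2 <= (VC (@hypercube_connected d) dt_dvd)%:R.
Proof.
(* With 1/4 the left side is [2 ^ d * (d + 1) ^ 2 / 2], at most [d * (d + 1) * 2 ^ d] once [d] is
   positive. *)
exists 4^-1 => [|[//|d] n _ -> dt dt_gt0 dt_dvd]; first by rewrite invr_gt0.
have dvd u : (d.+1 %| dt u)%N by rewrite -(deg_hypercube u).
have lt_VC := VC_hypercube_gt dt_gt0 dvd dt_dvd.
have -> : log2 (2 ^ d.+1)%:R = d.+1%:R :> R.
  rewrite /log2 natrX lnXn // -[ln _ *+ _]mulr_natl mulfK //.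
  by rewrite gt_eqF // ln_gt0 // ltr1n.
rewrite -mulrA -natrX -natrM mulrC ler_pdivrMr // -natrM ler_nat.
move: lt_VC; set V := VC _ _; rewrite expnS => lt_VC.
have p_gt0 : (0 < 2 ^ d)%N by rewrite expn_gt0.
(* In dimension 1 the bound is 1/2, and the strictness of [lt_VC] gives [V] at least 1. *)
case: d => [|d] in dt dt_gt0 dt_dvd dvd V lt_VC p_gt0 *; last nia.
by rewrite expn0; lia.
Qed.
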